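(* Let $a\leqslant b$ be two positive integers. Let $G=(X,Y)$ be a bipartite graph with parts $X,Y$, $|X|\leqslant |Y|$, containing no $[a,b]$-factor. (i) If $a|Y|>b|X|$, then $e(G)\leqslant |X||Y|$ with equality if and only if $G\cong K_{|X|,|Y|}$. (ii) If $a|Y|\leqslant b|X|$ and $a>|X|$, then $e(G)\leqslant |X||Y|$ with equality if and only if $G\cong K_{|X|,|Y|}$. (iii) If $a|Y|\leqslant b|X|$ and $a\leqslant |X|$, then $e(G)\leqslant |X|(|Y|-1)+a-1$ with equality if and only if $G\cong D(a-1,|X|-a+1;|Y|-1,1)$.
   Context: For positive integers $a\leqslant b$, an $[a,b]$-factor of a graph $G$ is a spanning subgraph $F$ with $a\leqslant d_F(v)\leqslant b$ for all $v$. For nonnegative integers $p_1,p_2,q_1,q_2$, $D(p_1,p_2;q_1,q_2)$ denotes the bipartite graph with parts $X=X_1\cup X_2$, $Y=Y_1\cup Y_2$ (disjoint), $|X_i|=p_i$, $|Y_i|=q_i$, in which every vertex of $X_1$ is adjacent to every vertex of $Y_1\cup Y_2$, every vertex of $X_2$ is adjacent to every vertex of $Y_1$, and there are no other edges (a double nested graph). *)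

(* Defs.v *)
From mathcomp Require Import all_boot.

Set Implicit Arguments.
Unset Strict Implicit.
Unset Printing Implicit Defensive.

Record sgraph := SGraph {
  vertex :> finType;
  adj : rel vertex;
  adj_sym : symmetric adj;
  adj_irr : irreflexive adj }.

Definition edges (G : sgraph) : {set {set G}} :=
  [set A | [exists u : G, exists v : G, adj u v && (A == [set u; v])]].

Definition num_edges (G : sgraph) : nat := #|edges G|.

Definition bipartition (G : sgraph) (X Y : {set G}) : Prop :=
  [/\ X :&: Y = set0, X :|: Y = [set: G] &
      forall u v : G, adj u v ->
        (u \in X /\ v \in Y) \/ (u \in Y /\ v \in X)].

(* A spanning subgraph of G is given by its adjacency relation on the vertices
   of G; it is irreflexive because it is contained in that of G. *)
Definition spanning_subgraph (G : sgraph) (F : rel G) : Prop :=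
  symmetric F /\ subrel F (@adj G).

Definition degree (T : finType) (F : rel T) (v : T) : nat := #|[set u | F v u]|.

Definition is_factor (a b : nat) (G : sgraph) (F : rel G) : Prop :=
  spanning_subgraph F /\ forall v : G, a <= degree F v <= b.

Definition has_factor (a b : nat) (G : sgraph) : Prop :=
  exists F : rel G, is_factor a b F.

(* Isomorphism of graphs, not of graphs with a fixed bipartition: the two parts
   may be exchanged. *)
Definition isomorphic (G H : sgraph) : Prop :=
  exists f : G -> H, bijective f /\ forall u v : G, adj (f u) (f v) = adj u v.

Section CompleteBipartite.
Variables m n : nat.

Definition Kadj : rel ('I_m + 'I_n)%type := fun u v =>
  match u, v with
  | inl _, inr _ | inr _, inl _ => true
  | _, _ => false
  end.

Lemma Kadj_sym : symmetric Kadj. Proof. by case=> ? [] ?. Qed.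
Lemma Kadj_irr : irreflexive Kadj. Proof. by case. Qed.

Definition K : sgraph := SGraph Kadj_sym Kadj_irr.
End CompleteBipartite.

Section DoubleNested.
Variables p1 p2 q1 q2 : nat.

(* inl (inl _) : X1, inl (inr _) : X2, inr (inl _) : Y1, inr (inr _) : Y2 *)
Definition Dadj : rel (('I_p1 + 'I_p2) + ('I_q1 + 'I_q2))%type := fun u v =>
  match u, v with
  | inl (inl _), inr _ | inr _, inl (inl _) => true
  | inl (inr _), inr (inl _) | inr (inl _), inl (inr _) => true
  | _, _ => false
  end.

Lemma Dadj_sym : symmetric Dadj.
Proof. by case=> [[] ?|[] ?] [[] ?|[] ?]. Qed.

Lemma Dadj_irr : irreflexive Dadj. Proof. by case=> [[] ?|[] ?]. Qed.

Definition D : sgraph := SGraph Dadj_sym Dadj_irr.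
End DoubleNested.

(* Main.v *)
Require Import Defs.
From mathcomp Require Import all_boot zify.

(** A bipartite graph has an [[a,b]]-factor as soon as
    a|A| <= b|B| + e(A, Y \ B) and a|B| <= b|A| + e(X \ A, B) for all A in X, B in Y:
    take a subgraph with degrees at most b and total deficiency minimal; if a
    vertex v has degree below a, then no alternating path from v can be
    augmented, and the set of vertices reached from v violates an inequality.
    When a|Y| <= b|X|, a <= |X| <= |Y|, all degrees are at least a and at most
    |X| - a + 1 edges are missing, these inequalities hold.  Hence a graph with
    at least |X|(|Y| - 1) + a - 1 edges and no factor has a vertex of degree
    below a, and that vertex alone accounts for all missing edges. *)

Set Implicit Arguments.
Unset Strict Implicit.
Unset Printing Implicit Defensive.

(** * Counting pairs between two vertex sets *)

Definition cross (T : finType) (r : rel T) (A B : {set T}) : nat :=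
  \sum_(x in A) \sum_(y in B) r x y.

Section Cross.
Variables (T : finType) (r : rel T).
Implicit Types A B C : {set T}.

Lemma crossC A B : symmetric r -> cross r A B = cross r B A.
Proof.
move=> r_sym; rewrite /cross exchange_big /=.
by apply: eq_bigr => x _; apply: eq_bigr => y _; rewrite r_sym.
Qed.

Lemma cross_sub A A' B B' :
  A \subset A' -> B \subset B' -> cross r A B <= cross r A' B'.
Proof.
move=> sA sB; rewrite /cross [X in _ <= X](big_setID A) /= (setIidPr sA).
apply: leq_trans (leq_addr _ _); apply: leq_sum => x _.
by rewrite [X in _ <= X](big_setID B) /= (setIidPr sB) leq_addr.
Qed.

Lemma cross_setID A B C : cross r A B = cross r A (B :&: C) + cross r A (B :\: C).
Proof. by rewrite /cross -big_split; apply: eq_bigr => x _; rewrite -big_setID. Qed.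

(** Turns a lower bound on the number of edges into an upper bound on the number of missing pairs,
    the form in which density is used below. *)
Lemma cross_compl A B : cross r A B + cross (fun x y => ~~ r x y) A B = #|A| * #|B|.
Proof.
rewrite /cross -big_split -sum_nat_const /=; apply: eq_bigr => x _.
rewrite -big_split -sum1_card /=; apply: eq_bigr => y _.
by case: (r x y).
Qed.

Lemma degree_sum x : degree r x = \sum_y r x y.
Proof. by rewrite /degree -sum1dep_card big_mkcond; apply: eq_bigr => y _; case: (r x y). Qed.

Lemma degree_sumE x B : (forall y, r x y -> y \in B) -> degree r x = \sum_(y in B) r x y.
Proof.
move=> rB; rewrite degree_sum [RHS]big_mkcond; apply: eq_bigr => y _.
by case: ifP => // /negbT; case: (boolP (r x y)) => // /rB ->.
Qed.

Lemma cross_degree A B :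
  (forall x y, x \in A -> r x y -> y \in B) -> cross r A B = \sum_(x in A) degree r x.
Proof. by move=> rB; apply: eq_bigr => x xA; rewrite (@degree_sumE x B) // => y; apply: rB. Qed.
End Cross.

Lemma eq_degree (T : finType) (r s : rel T) : r =2 s -> degree r =1 degree s.
Proof. by move=> rs x; apply: eq_card => y; rewrite !inE rs. Qed.

(** * Adding or deleting one edge *)

Definition toggle (T : eqType) (r : rel T) (x y : T) : rel T :=
  fun u w => r u w (+) ((u == x) && (w == y) || (u == y) && (w == x)).

Lemma toggle_sym (T : eqType) (r : rel T) x y : symmetric r -> symmetric (toggle r x y).
Proof. by move=> rs u w; rewrite /toggle rs orbC ![(w == _) && _]andbC. Qed.

Lemma degree_toggle_add (T : finType) (r : rel T) x y w :
  symmetric r -> x != y -> ~~ r x y ->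
  degree (toggle r x y) w = degree r w + (w == x) + (w == y).
Proof.
move=> rs nxy nr; rewrite /degree.
have [->|nwx] := eqVneq w x; last have [->|nwy] := eqVneq w y.
- rewrite (negPf nxy) addn0.
  have -> : [set u | toggle r x y x u] = y |: [set u | r x u].
    apply/setP => u; rewrite !inE /toggle eqxx (negPf nxy) /= orbF.
    by have [->|_] := eqVneq u y; rewrite ?(negPf nr) ?addbF.
  by rewrite cardsU1 inE nr addnC.
- rewrite addn0.
  have -> : [set u | toggle r x y y u] = x |: [set u | r y u].
    apply/setP => u; rewrite !inE /toggle eqxx eq_sym (negPf nxy) /=.
    by have [->|_] := eqVneq u x; rewrite ?addbF // rs (negPf nr).
  by rewrite cardsU1 inE rs nr addnC.
- rewrite !addn0; apply: eq_card => u.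
  by rewrite !inE /toggle (negPf nwx) (negPf nwy) addbF.
Qed.

(** Toggling twice restores [r], so this is [degree_toggle_add] for the toggled relation. *)
Lemma degree_toggle_del (T : finType) (r : rel T) x y w :
  symmetric r -> x != y -> r x y ->
  degree (toggle r x y) w + (w == x) + (w == y) = degree r w.
Proof.
move=> rs nxy rxy; rewrite -degree_toggle_add //; first last.
- by rewrite /toggle rxy !eqxx.
- exact: toggle_sym.
by apply: eq_degree => u v; rewrite /toggle addbK.
Qed.

(** * Alternating paths and the factor criterion *)

Section Bipartite.
Variable G : sgraph.
Implicit Types (F : rel G) (X Y A B : {set G}).

Lemma bipartitionC X Y : bipartition X Y -> bipartition Y X.
Proof.
by case=> dXY cXY bXY; split; [rewrite setIC|rewrite setUC|move=> u v /bXY []; [right|left]].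
Qed.

Lemma bipartition_notin X Y v : bipartition X Y -> (v \in Y) = (v \notin X).
Proof.
case=> dXY cXY _; have := in_setT v; have := in_set0 v; rewrite -dXY -cXY !inE.
by case: (v \in X); case: (v \in Y).
Qed.

Lemma adj_notin X Y u v : bipartition X Y -> adj u v -> (v \in X) = (u \notin X).
Proof.
move=> bip; have inY := bipartition_notin _ bip; case: (bip) => _ _ bXY /bXY.
by rewrite !inY; case: (u \in X); case: (v \in X) => //; case=> [] [].
Qed.

(** A directed relation: steps out of [X] use edges outside [F], steps into [X] use edges of [F].
    Along a path from a vertex of [X], edges are thus to be added and deleted in turn. *)
Definition alternating X F : rel G :=
  fun u w => if u \in X then adj u w && ~~ F u w else F u w.

Lemma spanning_toggle F x y :
  spanning_subgraph F -> adj x y -> spanning_subgraph (toggle F x y).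
Proof.
move=> [Fs Fsub] xy; split; first exact: toggle_sym.
move=> u w; rewrite /toggle.
case: (boolP (F u w)) => [/Fsub //|_] /= /orP [] /andP [/eqP -> /eqP ->] //.
by rewrite adj_sym.
Qed.

(* Toggling all edges of an alternating path changes the degrees of its two
   ends only; the memberships below record the directions of these changes. *)
Lemma alternating_augment X Y F v p :
  bipartition X Y -> spanning_subgraph F -> path (alternating X F) v p -> uniq (v :: p) ->
  exists2 F', spanning_subgraph F' & forall w,
    degree F' w + ((w == last v p) && (last v p \in X)) + ((w == v) && (v \notin X))
    = degree F w + ((w == v) && (v \in X)) + ((w == last v p) && (last v p \notin X)).
Proof.
move=> bip; elim: p v F => [|u p IH] v F spF /=.
  by move=> _ _; exists F => // w; case: (w == v); case: (v \in X); rewrite /= ?addn0.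
case: (spF) => Fs Fsub /andP [vu pth] /andP [vNup uniq_up].
have adj_vu : adj v u by move: vu; rewrite /alternating; case: ifP => _ => [/andP[]|/Fsub].
have nvu : v != u by apply: contraNneq vNup => ->; rewrite mem_head.
have [|F' spF' degF'] := IH u (toggle F v u) (spanning_toggle spF adj_vu) _ uniq_up.
  (* The rest of the path avoids [v], so toggling the edge [v u] leaves it alternating. *)
  have cont : {in u :: p, forall x, x != v}.
    by move=> x xin; apply: contraNneq vNup => <-.
  apply: (@sub_in_path _ (mem (u :: p))) (pth) => [x y xin yin|]; last by apply/allP.
  rewrite /alternating /toggle (negPf (cont x xin)) (negPf (cont y yin)) /= andbF.
  by rewrite addbF.
exists F' => // w; have := degF' w.
(* Since [u] and [v] lie in opposite parts, the change at [u] made by this toggle cancels the one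
   made by the rest of the path. *)
have uX := adj_notin bip adj_vu; rewrite uX.
move: vu; rewrite /alternating; case: ifP => /= vX => [/andP [_ nF]|Fvu].
  rewrite (degree_toggle_add w Fs nvu nF) !andbT !andbF; lia.
by rewrite -(degree_toggle_del w Fs nvu Fvu) !andbT !andbF; lia.
Qed.

Definition deficiency (a : nat) F : nat := \sum_v (a - degree F v).

Lemma reduce_deficiency a b X Y F v :
  bipartition X Y -> a <= b -> spanning_subgraph F -> (forall w, degree F w <= b) ->
  (forall A B, A \subset X -> B \subset Y ->
     a * #|A| <= b * #|B| + cross (@adj G) A (Y :\: B)) ->
  v \in X -> degree F v < a ->
  exists F', [/\ spanning_subgraph F', forall w, degree F' w <= b
               & deficiency a F' < deficiency a F].
Proof.
move=> bip ab spF Fb cond vX Fv; have inY w := bipartition_notin w bip.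
case: (spF) => Fs Fsub.
(* A path ending in [X] lowers the degree of its end and one ending in [Y] raises it; good vertices
   can afford this. *)
pose good w := if w \in X then a < degree F w else degree F w < b.
have [/existsP [w /andP [/connectP [p pth lw] gw]]|] :=
  boolP [exists w, connect (alternating X F) v w && good w].
  move: gw; rewrite lw; case/shortenP: pth => q pth uq _ gq.
  have [F' spF' degF'] := alternating_augment bip spF pth uq.
  have nv : v != last v q.
    by apply: contraTneq gq => <-; rewrite /good vX -leqNgt ltnW.
  move: gq; rewrite /good => gq.
  exists F'; split=> // [w'|].
    have := degF' w'; rewrite vX andbF andbT addn0; have := Fb w'.
    have [->|_] := eqVneq w' v; first by rewrite (negPf nv) /=; lia.
    have [->|_] /= := eqVneq w' (last v q); last by lia.
    by move: gq; case: ifP => _ /=; lia.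
  rewrite /deficiency (bigD1 v) //= [X in _ < X](bigD1 v) //= -addSn leq_add //.
    by have := degF' v; rewrite eqxx vX (negPf nv) /=; lia.
  apply: leq_sum => w' nw'; have := degF' w'; rewrite (negPf nw') /=.
  have [->|_] /= := eqVneq w' (last v q); last by lia.
  by move: gq; case: ifP => _ /=; lia.
(* No good vertex is reached. The F-degrees over the reached set [A] then sum to b|B| + e(A, Y \ B),
   but also to less than a|A| because of [v]. *)
move=> /existsPn noaug; exfalso.
pose A := [set x in X | connect (alternating X F) v x].
pose B := [set y in Y | connect (alternating X F) v y].
have sA : A \subset X by apply/subsetP => x; rewrite inE => /andP [].
have sB : B \subset Y by apply/subsetP => x; rewrite inE => /andP [].
have vA : v \in A by rewrite inE vX connect0.
have degA x : x \in A -> degree F x <= a.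
  rewrite inE => /andP [xX vx]; have := noaug x.
  by rewrite vx /good xX -leqNgt.
have degB y : y \in B -> degree F y = b.
  rewrite inE inY => /andP [yX vy]; have := noaug y.
  rewrite vy /good (negPf yX) -leqNgt => le; apply/eqP; rewrite eqn_leq le.
  by rewrite Fb.
have sumA : \sum_(x in A) degree F x < a * #|A|.
  rewrite mulnC -sum_nat_const (bigD1 v) //= [X in _ < X](bigD1 v) //=.
  by rewrite -addSn leq_add //; apply: leq_sum => x /andP [/degA].
have FAY : cross F A Y = \sum_(x in A) degree F x.
  apply: cross_degree => x y /(subsetP sA) xX /Fsub /(adj_notin bip).
  by rewrite inY xX => ->.
(* Every F-neighbour of a reached vertex of [Y] is reached, and such a vertex has degree exactly
   b. *)
have FAB : cross F A B = b * #|B|.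
  rewrite crossC // (@cross_degree _ F B A).
    by rewrite (eq_bigr _ degB) sum_nat_const mulnC.
  move=> y x; rewrite !inE inY => /andP [yX vy] Fyx.
  rewrite (adj_notin bip (Fsub _ _ Fyx)) yX /=.
  by apply: connect_trans vy (connect1 _); rewrite /alternating (negPf yX).
(* An edge from [A] outside [F] would make its other end reached, hence put it in [B]. *)
have FAD : cross F A (Y :\: B) = cross (@adj G) A (Y :\: B).
  apply: eq_bigr => x; rewrite inE => /andP [xX vx]; apply: eq_bigr => y.
  rewrite !inE => /andP [yB yY]; congr nat_of_bool.
  apply/idP/idP => [/Fsub //|xy]; apply: contraR yB => nF.
  rewrite yY; apply: connect_trans vx (connect1 _).
  by rewrite /alternating xX xy.
have := cond A B sA sB.
rewrite -FAD -FAB -{1}(setIidPr sB) -cross_setID FAY; lia.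
Qed.

(** Induction on the deficiency, starting from the empty subgraph. The two conditions serve
    deficient vertices in [X] and in [Y]; the second case is the first with the parts exchanged. *)
Lemma bipartite_factor_criterion a b X Y :
  bipartition X Y -> a <= b ->
  (forall A B, A \subset X -> B \subset Y ->
     a * #|A| <= b * #|B| + cross (@adj G) A (Y :\: B)) ->
  (forall A B, A \subset X -> B \subset Y ->
     a * #|B| <= b * #|A| + cross (@adj G) (X :\: A) B) ->
  has_factor a b G.
Proof.
move=> bip ab condX condY.
suff step n F : spanning_subgraph F -> (forall w, degree F w <= b) -> deficiency a F <= n ->
    has_factor a b G.
  apply: (step _ (fun _ _ => false) _ _ (leqnn _)); first by split.
  by move=> w; rewrite /degree (_ : [set _ | _] = set0) ?cards0 //; apply/setP => u; rewrite !inE.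
elim: n F => [|n IH] F spF Fb def.
  exists F; split=> // v; rewrite Fb andbT -subn_eq0.
  by move: def; rewrite leqn0 sum_nat_eq0 => /forallP /(_ v).
have [/existsP [v Fv]|/existsPn aF] := boolP [exists v, degree F v < a]; last first.
  by exists F; split=> // v; rewrite Fb andbT leqNgt aF.
suff [F' [spF' Fb' def']] : exists F',
    [/\ spanning_subgraph F', forall w, degree F' w <= b & deficiency a F' < deficiency a F].
  by apply: (IH F') => //; rewrite -ltnS (leq_trans def' def).
have [vX|vX] := boolP (v \in X); first exact: (reduce_deficiency bip ab spF Fb condX vX Fv).
apply: (reduce_deficiency (bipartitionC bip) ab spF Fb) Fv; last by rewrite (bipartition_notin v bip).
by move=> A B sA sB; rewrite (crossC _ _ (@adj_sym G)); apply: condY.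
Qed.
End Bipartite.

(** * Edge counts of bipartite graphs *)

Section EdgeCount.
Variables (G : sgraph) (X Y : {set G}).
Hypothesis bip : bipartition X Y.

(** Orienting each edge from [X] to [Y] matches unordered edges with ordered pairs; it is injective
    because the parts are disjoint. *)
Lemma num_edges_cross : num_edges G = cross (@adj G) X Y.
Proof.
have inY := bipartition_notin _ bip.
pose P := [set p | [&& p.1 \in X, p.2 \in Y & adj p.1 p.2]].
have -> : num_edges G = #|[set [set p.1; p.2] | p in P]|.
  apply: eq_card => A; rewrite inE; apply/existsP/imsetP => [[u /existsP [v /andP [uv /eqP ->]]]|].
    have vX := adj_notin bip uv.
    have [uX|uX] := boolP (u \in X); first by exists (u, v); rewrite // inE /= inY vX uX.
    by exists (v, u); rewrite ?inE /= 1?setUC // adj_sym uv inY vX uX.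
  move=> [[u v]]; rewrite inE /= => /and3P [_ _ uv] ->.
  by exists u; apply/existsP; exists v; rewrite uv eqxx.
rewrite card_in_imset => [|[x y] [x' y']]; last first.
  rewrite !inE /= !inY => /and3P [xX yX _] /and3P [x'X y'X _] /setP E.
  have := E x; rewrite !inE eqxx /= => /esym /orP [] /eqP ex; last by move: xX; rewrite ex (negPf y'X).
  have := E y; rewrite !inE eqxx orbT /= => /esym /orP [] /eqP ey; first by move: yX; rewrite ey x'X.
  by rewrite ex ey.
rewrite /cross pair_big -sum1dep_card big_mkcond [RHS]big_mkcond /=; apply: eq_bigr => [[x y]] _ /=.
by case: (x \in X); case: (y \in Y); case: (adj x y).
Qed.

Lemma cross_partr (A : {set G}) : A \subset X -> cross (@adj G) A Y = \sum_(x in A) degree (@adj G) x.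
Proof.
move=> sA; apply: cross_degree => x y /(subsetP sA) xX /(adj_notin bip).
by rewrite (bipartition_notin y bip) xX => ->.
Qed.

Lemma num_edges_le : num_edges G <= #|X| * #|Y|.
Proof. by rewrite num_edges_cross -(cross_compl (@adj G)) leq_addr. Qed.

Lemma num_edges_complete :
  num_edges G = #|X| * #|Y| <-> {in X & Y, forall x y, adj x y}.
Proof.
rewrite num_edges_cross -(cross_compl (@adj G)); split=> [eq x y xX yY|full].
  have no : 0 = cross (fun u v => ~~ @adj G u v) X Y by lia.
  have := @cross_sub _ (fun u v => ~~ adj u v) [set x] X [set y] Y.
  by rewrite !sub1set -no /cross !big_set1 => /(_ xX yY); case: (adj x y).
rewrite [cross (fun _ _ => ~~ _) _ _]big1 ?addn0 // => x xX.
by rewrite big1 // => y yY; rewrite full.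
Qed.
End EdgeCount.

(** * Graphs complete away from one vertex *)

Section NearlyComplete.
Variables (G : sgraph) (X Y : {set G}) (y : G).
Hypotheses (bip : bipartition X Y) (yY : y \in Y).

Lemma num_edges_split :
  num_edges G = degree (@adj G) y + cross (@adj G) (Y :\ y) X.
Proof.
have bipC := bipartitionC bip.
rewrite (num_edges_cross bipC) !(cross_partr bipC) ?subsetDl // (big_setD1 y) //.
Qed.

Lemma num_edges_nearly_complete :
  (forall x z, x \in X -> z \in Y -> z != y -> adj x z) ->
  num_edges G = #|X| * (#|Y| - 1) + degree (@adj G) y.
Proof.
move=> full; rewrite num_edges_split addnC; congr (_ + _).
rewrite mulnC subn1 (cardsD1 y Y) yY add1n /= -(cross_compl (@adj G)).
rewrite [cross (fun _ _ => ~~ _) _ _]big1 ?addn0 // => z; rewrite !inE => /andP [nz zY].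
by rewrite big1 // => x xX; rewrite adj_sym full.
Qed.

(** At least |X| - a + 1 pairs are missing at [y], which is the whole allowance; one more missing
    pair, at [y] or elsewhere, would exceed it. *)
Lemma low_degree_nearly_complete a :
  degree (@adj G) y < a -> a <= #|X| -> #|X| * #|Y| <= num_edges G + (#|X| - a + 1) ->
  degree (@adj G) y = a - 1 /\ forall x z, x \in X -> z \in Y -> z != y -> adj x z.
Proof.
move=> dy aX; rewrite num_edges_split => le.
have cY : #|Y| = #|Y :\ y| .+1 by rewrite (cardsD1 y) yY.
have tot := cross_compl (@adj G) (Y :\ y) X.
split; first by rewrite cY in le; nia.
move=> x z xX zY nz; rewrite -[adj x z]negbK; apply/negP => nadj.
have := @cross_sub _ (fun u v => ~~ adj u v) [set z] (Y :\ y) [set x] X.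
rewrite !sub1set !inE nz zY xX /cross !big_set1 adj_sym nadj -/(cross _ _ _) => /(_ isT isT).
by rewrite cY in le; nia.
Qed.
End NearlyComplete.

(** * Isomorphisms with the extremal graphs *)

Section Isomorphism.
Variables G H : sgraph.

Lemma isomorphic_num_edges : isomorphic G H -> num_edges G = num_edges H.
Proof.
move=> [f [bf adjf]]; have f_inj := bij_inj bf; case: bf => g fK gK.
rewrite /num_edges -(card_imset _ (imset_inj f_inj)); apply: eq_card => A.
apply/imsetP/idP => [[B]|].
  rewrite !inE => /existsP [u /existsP [v /andP [uv /eqP ->]]] ->.
  apply/existsP; exists (f u); apply/existsP; exists (f v).
  by rewrite adjf uv imsetU1 imset_set1 eqxx.
rewrite inE => /existsP [u /existsP [v /andP [uv /eqP ->]]].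
exists [set g u; g v]; last by rewrite imsetU1 imset_set1 !gK.
by rewrite inE; apply/existsP; exists (g u); apply/existsP; exists (g v); rewrite -adjf !gK uv eqxx.
Qed.

(** The map starts from the model, where it can be defined by cases on the summands. *)
Lemma isomorphic_from (h : H -> G) :
  injective h -> #|G| <= #|H| -> (forall u v, adj (h u) (h v) = adj u v) -> isomorphic G H.
Proof.
move=> h_inj cGH adjh; have [g hK gK] := inj_card_bij h_inj cGH.
by exists g; split; [exists h | move=> u v; rewrite -adjh !gK].
Qed.
End Isomorphism.

Section Models.
Variables (G : sgraph) (X Y : {set G}).
Hypothesis bip : bipartition X Y.

Lemma card_bipartition : #|G| = #|X| + #|Y|.
Proof. by case: bip => dXY cXY _; rewrite -cardsUI dXY cXY cards0 addn0 cardsT. Qed.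

Lemma adj_part u v : adj u v -> (u \in X) (+) (v \in X).
Proof. by move=> uv; rewrite (adj_notin bip uv); case: (u \in X). Qed.

Lemma isomorphic_K : {in X & Y, forall x y, adj x y} -> isomorphic G (K #|X| #|Y|).
Proof.
move=> full; have inY := bipartition_notin _ bip.
pose h (u : K #|X| #|Y|) : G :=
  match u with inl i => enum_val i | inr j => enum_val j end.
have hX u : (h u \in X) = if u is inl _ then true else false.
  by case: u => i /=; have := enum_valP i; rewrite ?inY // => /negPf.
apply: (@isomorphic_from _ _ h).
- move=> u v e; have := hX u; rewrite e hX.
  by case: u v e => [i|i] [j|j] //= /enum_val_inj ->.
- by rewrite card_sum !card_ord card_bipartition.
move=> u v; apply/idP/idP => [/adj_part|].
  by rewrite !hX; case: u v => [i|i] [j|j].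
case: u v => [i|i] [j|j] //= _; last rewrite adj_sym; apply: full; exact: enum_valP.
Qed.

Lemma isomorphic_D (X1 Y1 : {set G}) p1 p2 q1 q2 :
  X1 \subset X -> Y1 \subset Y ->
  #|X1| = p1 -> #|X :\: X1| = p2 -> #|Y1| = q1 -> #|Y :\: Y1| = q2 ->
  {in X & Y, forall x y, adj x y = (x \in X1) || (y \in Y1)} ->
  isomorphic G (D p1 p2 q1 q2).
Proof.
move=> sX sY <- <- <- <- adjE; have inY := bipartition_notin _ bip.
pose h (u : D #|X1| #|X :\: X1| #|Y1| #|Y :\: Y1|) : G :=
  match u with
  | inl (inl i) => enum_val i | inl (inr i) => enum_val i
  | inr (inl i) => enum_val i | inr (inr i) => enum_val i
  end.
(* Membership of [h u] in [X], [X1] and [Y1] determines the summand of [u]; this yields both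
   injectivity and preservation of adjacency. *)
have hX u : (h u \in X) = if u is inl _ then true else false.
  case: u => [[] i|[] i] /=; have := enum_valP i; rewrite ?inE.
  - exact: (subsetP sX).
  - by case/andP.
  - by move/(subsetP sY); rewrite inY => /negPf.
  - by case/andP => _; rewrite inY => /negPf.
have hX1 u : (h u \in X1) = if u is inl (inl _) then true else false.
  have := hX u; case: u => [[] i|[] i] /= hi.
  - exact: enum_valP.
  - by have := enum_valP i; rewrite inE => /andP [/negPf].
  - by apply: contraFF hi => /(subsetP sX).
  - by apply: contraFF hi => /(subsetP sX).
have hY1 u : (h u \in Y1) = if u is inr (inl _) then true else false.
  have := hX u; case: u => [[] i|[] i] /= hi.
  - by apply: contraTF hi => /(subsetP sY); rewrite inY.
  - by apply: contraTF hi => /(subsetP sY); rewrite inY.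
  - exact: enum_valP.
  - by have := enum_valP i; rewrite inE => /andP [/negPf].
apply: (@isomorphic_from _ _ h).
- move=> u v e; have := hX u; have := hX1 u; have := hY1 u; rewrite e hX hX1 hY1.
  by case: u v e => [[] i|[] i] [[] j|[] j] //= /enum_val_inj ->.
- rewrite !card_sum !card_ord card_bipartition.
  by rewrite -(cardsID X1 X) -(cardsID Y1 Y) (setIidPr sX) (setIidPr sY).
move=> u v.
have [uX|uX] := boolP (h u \in X); have [vX|vX] := boolP (h v \in X).
- transitivity false; first by apply/idP => /adj_part; rewrite uX vX.
  by move: uX vX; rewrite !hX; case: u v => [[] i|[] i] [[] j|[] j].
- rewrite adjE ?inY // hX1 hY1.
  by move: uX vX; rewrite !hX; case: u v => [[] i|[] i] [[] j|[] j].
- rewrite adj_sym adjE ?inY // hX1 hY1.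
  by move: uX vX; rewrite !hX; case: u v => [[] i|[] i] [[] j|[] j].
- transitivity false; first by apply/idP => /adj_part; rewrite (negPf uX) (negPf vX).
  by move: uX vX; rewrite !hX; case: u v => [[] i|[] i] [[] j|[] j].
Qed.

(** Here X1 is the neighbourhood of [y] and Y2 is {y}. *)
Lemma isomorphic_D_nearly_complete y :
  y \in Y -> (forall x z, x \in X -> z \in Y -> z != y -> adj x z) ->
  isomorphic G (D (degree (@adj G) y) (#|X| - degree (@adj G) y) (#|Y| - 1) 1).
Proof.
move=> yY full; have inY := bipartition_notin _ bip.
have sN : [set x | adj y x] \subset X.
  by apply/subsetP => x; rewrite inE => /(adj_notin bip) ->; rewrite -inY.
apply: (@isomorphic_D [set x | adj y x] (Y :\ y)) => //.
- exact: subsetDl.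
- by rewrite cardsD (setIidPr sN).
- by rewrite (cardsD1 y Y) yY add1n subn1.
- by rewrite setDDr setDv set0U (setIidPr _) ?cards1 // sub1set.
move=> x z xX zY; rewrite !inE zY andbT.
by have [->|nz] := eqVneq z y; [rewrite orbF adj_sym | rewrite orbT full].
Qed.
End Models.

Lemma num_edges_K m n : num_edges (K m n) = m * n.
Proof.
pose X := [set u : K m n | if u is inl _ then true else false].
pose Y := [set u : K m n | if u is inr _ then true else false].
have bip : bipartition X Y.
  split; first by apply/setP => -[] i; rewrite !inE.
    by apply/setP => -[] i; rewrite !inE.
  by move=> [i|i] [j|j] //= _; rewrite !inE; [left|right].
have -> : num_edges (K m n) = #|X| * #|Y|.
  by apply/(num_edges_complete bip) => -[] i [] j; rewrite !inE.
have -> : X = [set inl i | i in 'I_m].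
  apply/setP => -[] i; rewrite !inE; first by rewrite imset_f.
  by apply/esym/imsetP => -[].
have -> : Y = [set inr i | i in 'I_n].
  apply/setP => -[] i; rewrite !inE; last by rewrite imset_f.
  by apply/esym/imsetP => -[].
by rewrite (card_imset _ inl_inj) (card_imset _ inr_inj) !card_ord.
Qed.

Lemma num_edges_D p1 p2 q : num_edges (D p1 p2 q 1) = (p1 + p2) * q + p1.
Proof.
pose H := D p1 p2 q 1.
pose X := [set u : H | if u is inl _ then true else false].
pose Y := [set u : H | if u is inr _ then true else false].
pose y : H := inr (inr ord0).
have bip : bipartition X Y.
  split; first by apply/setP => -[] i; rewrite !inE.
    by apply/setP => -[] i; rewrite !inE.
  by move=> [i|i] [j|j]; rewrite !inE /=; [case: i j => i [] j | left | right | case: i j => i [] j].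
have yY : y \in Y by rewrite inE.
have -> := num_edges_nearly_complete bip yY; last first.
  move=> [[]i|i] [j|[]j]; rewrite !inE //= => _ _.
  by rewrite /y [j]ord1 eqxx.
have -> : #|X| = p1 + p2.
  have -> : X = [set inl i | i in {: 'I_p1 + 'I_p2}].
    apply/setP => -[] i; rewrite !inE; first by rewrite imset_f.
    by apply/esym/imsetP => -[].
  by rewrite (card_imset _ inl_inj) card_sum !card_ord.
have -> : #|Y| = q + 1.
  have -> : Y = [set inr i | i in {: 'I_q + 'I_1}].
    apply/setP => -[] i; rewrite !inE; last by rewrite imset_f.
    by apply/esym/imsetP => -[].
  by rewrite (card_imset _ inr_inj) card_sum !card_ord.
rewrite addnK; congr (_ + _).
have -> : degree (@adj H) y = #|[set (inl (inl i) : H) | i in 'I_p1]|.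
  apply: eq_card => -[[] i|[] i]; rewrite !inE /=.
  - by apply/esym/imsetP; exists i.
  - by apply/esym/imsetP => -[].
  - by apply/esym/imsetP => -[].
  - by apply/esym/imsetP => -[].
by rewrite card_imset ?card_ord // => i j [].
Qed.

(** * Arithmetic behind the factor criterion *)

(* [c] counts the missing edges, and |A| = s, |B| = t, |Y \ B| = k, resp.
   |X \ A| = j in the second lemma.  There the averaged bound b s >= a n s / m
   is too weak by one in the case t = n, where the minimum degree takes over. *)
Lemma factor_slack_X a b m n s t k c :
  a <= b -> t + k = n -> 0 < t -> t < s -> s < m -> m <= n -> c <= m - a + 1 -> a <= m ->
  a * s + c <= b * t + s * k.
Proof.
move=> ab tk t0 ts sm mn cm am.
(* The extreme values b = a and c = m - a + 1 suffice. *)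
suff: a * s + (m - a + 1) <= a * t + s * k by nia.
have [ka|ka] := leqP a k; nia.
Qed.

Lemma factor_slack_Y a b m n s t j c :
  0 < a -> a <= b -> a * n <= b * m -> s + j = m -> 0 < s -> 0 < j -> s < t -> t <= n ->
  m <= n -> a <= m -> c <= m - a + 1 -> (a = m -> c = 0) ->
  a * t + c <= b * s + t * j \/ (t = n /\ a * n <= b * s + a * j).
Proof.
move=> a0 ab an sj s0 j0 st tn mn am cm c0.
have [aj|ja] := leqP a j.
  have [j2|j1] := leqP 2 j; first by left; nia.
  have ej : j = 1 by lia.
  have ea : a = 1 by lia.
  subst j a; have [b2|b1] := leqP 2 b; first by left; nia.
  have eb : b = 1 by lia.
  by subst b; right; split; nia.
have [e ea] : exists e, a = j + e by exists (a - j); lia.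
have [d ed] : exists d, m = a + d by exists (m - a); lia.
(* From a = j + e, s = e + d and m = j + e + d one gets a s = m e + j d, so this is a n <= b m
   multiplied by s. *)
have key : m * (n * e) + n * (j * d) <= m * (b * s).
  have: a * n * s <= b * m * s by rewrite leq_mul2r an orbT.
  have -> : s = e + d by lia.
  rewrite ed ea; nia.
have key' : n * e + j * d <= b * s.
  rewrite -(@leq_pmul2l m); last by lia.
  apply: leq_trans key; rewrite mulnDr leq_add2l.
  by rewrite leq_mul2r mn orbT.
(* After cancelling j t, the first alternative reads e t + c <= b s, with c <= d + 1 and e > 0. For
   t < n the spare e absorbs the extra one in c. *)
have [t_lt|tn'] := ltnP t n.
  left; have -> : a * t = j * t + e * t by rewrite ea mulnDl.
  have : e * t + e <= n * e by rewrite -mulnSr mulnC leq_mul2r t_lt orbT.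
  have : d <= j * d by rewrite leq_pmull.
  nia.
have -> : t = n by lia.
case: (posnP d) => [d0|d0].
  by left; rewrite c0; [rewrite ea; nia | lia].
have [j2|j1] := leqP 2 j.
  by left; have : 2 * d <= j * d by [rewrite leq_mul2r j2 orbT]; rewrite ea; nia.
have ej : j = 1 by lia.
(* If n = m, then a <= b and a n = a s + a j give the second alternative. If m < n, the bound m <= n
   was used with loss, so [key] yields a strict inequality. *)
have [nm|m_lt] := leqP n m; first by right; split=> //; rewrite ej; nia.
left; suff: n * e + d < b * s by rewrite ea ej; nia.
rewrite -(@ltn_pmul2l m); last by lia.
apply: leq_trans key; rewrite ej mul1n mulnDr -addnS leq_add2l.
by rewrite ltn_mul2r d0.
Qed.

(** * Dense graphs of minimum degree at least a have factors *)

Section DenseFactor.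
Variables (a b : nat) (G : sgraph) (X Y : {set G}).
Hypotheses (bip : bipartition X Y) (a_gt0 : 0 < a) (ab : a <= b).
Hypotheses (XY : #|X| <= #|Y|) (aYbX : a * #|Y| <= b * #|X|) (aX : a <= #|X|).
Hypothesis min_deg : forall v, a <= degree (@adj G) v.
Hypothesis dense : #|X| * #|Y| <= num_edges G + (#|X| - a + 1).

Lemma dense_has_factor : has_factor a b G.
Proof.
have bipC := bipartitionC bip.
pose c := cross (fun u v => ~~ @adj G u v) X Y.
have cE := cross_compl (@adj G) X Y; rewrite -/c in cE.
have c_le : c <= #|X| - a + 1 by move: dense; rewrite (num_edges_cross bip); lia.
have missing (A B : {set G}) : A \subset X -> B \subset Y -> #|A| * #|B| <= cross (@adj G) A B + c.
  by move=> sA sB; rewrite -(cross_compl (@adj G)) leq_add2l cross_sub.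
have degX (A : {set G}) : A \subset X -> a * #|A| <= cross (@adj G) A Y.
  by move=> sA; rewrite (cross_partr bip) // mulnC -sum_nat_const leq_sum.
have degY (B : {set G}) : B \subset Y -> a * #|B| <= cross (@adj G) X B.
  move=> sB; rewrite crossC ?(cross_partr bipC) // => [|u v]; last exact: adj_sym.
  by rewrite mulnC -sum_nat_const leq_sum.
(* Every vertex of [Y] then has degree at least |X|, so nothing is missing. *)
have c0 : a = #|X| -> c = 0.
  by move=> aE; have := degY Y (subxx _); rewrite aE; lia.
have cardD (A B : {set G}) : A \subset B -> #|A| + #|B :\: A| = #|B|.
  by move=> sAB; rewrite -[RHS](cardsID A) (setIidPr sAB).
apply: (bipartite_factor_criterion bip ab) => A B sA sB.
- have [AB|BA] := leqP #|A| #|B|.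
    by apply: leq_trans (leq_addr _ _); apply: leq_mul.
  have [B0|B_gt0] := posnP #|B|.
    by rewrite (cards0_eq B0) setD0 cards0 muln0 degX.
  have cB := cardD _ _ sB; have sYB : Y :\: B \subset Y by apply: subsetDl.
  (* For A = X, split a|X| <= a|Y| into the shares of [B] and [Y :\: B]; minimum degree covers the
     latter. *)
  have [XA|AX] := leqP #|X| #|A|.
    have -> : A = X by apply/eqP; rewrite eqEcard sA.
    have := degY _ sYB; have : a * #|B| <= b * #|B| by rewrite leq_mul2r ab orbT.
    have : a * #|X| <= a * #|Y| by rewrite leq_mul2l XY orbT.
    rewrite -cB mulnDr; lia.
  have := factor_slack_X ab cB B_gt0 BA AX XY c_le aX.
  by have := missing _ _ sA sYB; lia.
- have [BA|AB] := leqP #|B| #|A|.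
    by apply: leq_trans (leq_addr _ _); apply: leq_mul.
  have [A0|A_gt0] := posnP #|A|.
    by rewrite (cards0_eq A0) setD0 cards0 muln0 degY.
  have cA := cardD _ _ sA; have sXA : X :\: A \subset X by apply: subsetDl.
  have BY := subset_leq_card sB.
  have [XA0|XA_gt0] := posnP #|X :\: A|.
    apply: leq_trans (leq_addr _ _); rewrite -(_ : #|X| = #|A|); last by lia.
    by apply: leq_trans aYbX; rewrite leq_mul2l BY orbT.
  have [le|[BYE le]] := factor_slack_Y a_gt0 ab aYbX cA A_gt0 XA_gt0 AB BY XY aX c_le c0.
    by have := missing _ _ sXA sB; rewrite mulnC; lia.
  (* With B = Y, minimum degree gives at least a|X \ A| edges from [X :\: A] to [B]. *)
  have -> : B = Y by apply/eqP; rewrite eqEcard sB BYE leqnn.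
  by apply: leq_trans le _; rewrite leq_add2l (degX _ sXA).
Qed.
End DenseFactor.

(** * The extremal bounds and their equality cases *)

Theorem theorem1p3 (a b : nat) (ha : 0 < a) (hab : a <= b)
    (G : sgraph) (X Y : {set G}) (hG : bipartition X Y) (hXY : #|X| <= #|Y|)
    (hF : ~ has_factor a b G) :
  [/\ b * #|X| < a * #|Y| ->
        num_edges G <= #|X| * #|Y| /\
        (num_edges G = #|X| * #|Y| <-> isomorphic G (K #|X| #|Y|)),
      a * #|Y| <= b * #|X| -> #|X| < a ->
        num_edges G <= #|X| * #|Y| /\
        (num_edges G = #|X| * #|Y| <-> isomorphic G (K #|X| #|Y|))
    & a * #|Y| <= b * #|X| -> a <= #|X| ->
        num_edges G <= #|X| * (#|Y| - 1) + (a - 1) /\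
        (num_edges G = #|X| * (#|Y| - 1) + (a - 1) <->
         isomorphic G (D (a - 1) (#|X| - a + 1) (#|Y| - 1) 1))].
Proof.
(* Cases (i) and (ii) share the trivial bound, attained only by the complete bipartite graph. *)
have complete : num_edges G <= #|X| * #|Y| /\
    (num_edges G = #|X| * #|Y| <-> isomorphic G (K #|X| #|Y|)).
  split; first exact: num_edges_le.
  split=> [/(num_edges_complete hG)|/isomorphic_num_edges ->]; first exact: isomorphic_K.
  exact: num_edges_K.
split=> // aYbX aX.
(* The truncated |Y| - 1 is exact, since 0 < a <= |X| <= |Y|. *)
have cY : #|X| * #|Y| = #|X| * (#|Y| - 1) + #|X| by rewrite -mulnSr; congr (_ * _); lia.
suff extremal : #|X| * (#|Y| - 1) + (a - 1) <= num_edges G ->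
    num_edges G = #|X| * (#|Y| - 1) + (a - 1) /\
    isomorphic G (D (a - 1) (#|X| - a + 1) (#|Y| - 1) 1).
  split; first by rewrite leqNgt; apply/negP => gt; have [eq _] := extremal (ltnW gt); lia.
  split=> [eq|/isomorphic_num_edges ->]; first by apply extremal; rewrite eq.
  by rewrite num_edges_D; congr (_ * _ + _); lia.
move=> many; have dense : #|X| * #|Y| <= num_edges G + (#|X| - a + 1) by lia.
have pE : #|X| - (a - 1) = #|X| - a + 1 by lia.
have [/existsP [v dv]|/existsPn min_deg] := boolP [exists v, degree (@adj G) v < a]; last first.
  by case: hF; apply: (dense_has_factor hG) => // v; rewrite leqNgt min_deg.
have [vX|vX] := boolP (v \in X); last first.
  rewrite -(bipartition_notin v hG) in vX.
  have [dE full] := low_degree_nearly_complete hG vX dv aX dense.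
  have := isomorphic_D_nearly_complete hG vX full.
  by rewrite (num_edges_nearly_complete hG vX full) dE pE.
have hGC := bipartitionC hG.
(* A deficient vertex of [X] misses at least |Y| - a + 1 edges, which forces
   |X| = |Y|; the parts then play symmetric roles. *)
have XYE : #|X| = #|Y|.
  have := num_edges_split hGC vX; have := cross_compl (@adj G) (X :\ v) Y.
  have cX : #|X| = #|X :\ v|.+1 by rewrite (cardsD1 v) vX.
  move: dense hXY aX; rewrite cX mulSn; lia.
have aY : a <= #|Y| by rewrite -XYE.
have denseC : #|Y| * #|X| <= num_edges G + (#|Y| - a + 1) by rewrite mulnC -XYE {2}XYE.
have [dE full] := low_degree_nearly_complete hGC vX dv aY denseC.
(* The model obtained has the parts exchanged; |X| = |Y| makes its parameters the required ones. *)
have := isomorphic_D_nearly_complete hGC vX full.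
by rewrite (num_edges_nearly_complete hGC vX full) dE -XYE pE.
Qed.
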